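(* The following bounds hold (all parameters are integers). (i) For all $h \geq 1$ and $k \geq \lceil h/2\rceil$, $$\phi(h, k) > \frac{ (k - \lceil h/2\rceil)^h }{ \lceil h/2\rceil!\, \lfloor h/2\rfloor! } .$$ (ii) For all $h \geq 1$ and $v \geq 2$, $$f_{h}(v) < v^{\frac{1}{h}} \cdot \left( \lfloor h/2\rfloor!\,\lceil h/2\rceil! \right)^{\frac{1}{h}} + \lceil h/2\rceil .$$ (iii) For all $k = n + 1 \geq 2$ and $h \geq 2k - 4$, $$\phi(h, k) > \frac{ (h - 2n + 2)^n }{ n! } \cdot \frac{ \binom{2n}{n} }{2^n} .$$ (iv) For all $k = n + 1 \geq 2$ and $v \geq 2$ (such that $h_k(v)$ is defined, i.e. $v\ge k$), $$h_k(v) < v^{\frac{1}{n}} \cdot 2 \left( \frac{(n!)^3}{(2n)!} \right)^{\frac{1}{n}} + 2n - 2 .$$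
   Context: For an Abelian group $G$ (written additively), a set $B=\{b_0,b_1,\ldots,b_{k-1}\}\subseteq G$ of $k$ distinct elements is a Sidon set of order $h$ (a $B_h$ set) if the sums $b_{i_1}+\cdots+b_{i_h}$, over all index sequences $0\le i_1\le\cdots\le i_h\le k-1$, are all different (for $h=0$ the condition is vacuous). All groups below are finite and Abelian, not necessarily cyclic. - $f_h(v)$ is the maximum cardinality of a $B_h$ set in an arbitrary Abelian group of order $v$ (the maximum is over all Abelian groups of order $v$ and all $B_h$ sets in them). - $h_k(v)$ is the largest $h$ for which there is a $B_h$ set of cardinality $k$ in some Abelian group of order $v$. - $\phi(h,k)$ is the order of the smallest finite Abelian group containing a $B_h$ set of cardinality $k$. *)

(* Defs.v *)
From HB Require Import structures.
From mathcomp Require Import all_boot all_order all_algebra.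
From mathcomp Require Import boolp classical_sets.

Set Implicit Arguments.
Unset Strict Implicit.
Unset Printing Implicit Defensive.

Import GRing.Theory.
Local Open Scope ring_scope.

(* [enum_val] lists the elements of B as b_0, ..., b_(k-1), with k = #|B|;
   whether B is a B_h set does not depend on the listing, see [Bh_setP]. *)
Definition Bh_set (G : finZmodType) (h : nat) (B : {set G}) : Prop :=
  forall i j : h.-tuple 'I_#|B|,
    sorted leq [seq val x | x <- i] -> sorted leq [seq val x | x <- j] ->
    \sum_(x <- i) enum_val x = \sum_(x <- j) enum_val x -> i = j.

Definition has_Bh (h k v : nat) : Prop :=
  exists (G : finZmodType) (B : {set G}),
    [/\ #|[set: G]| = v, #|B| = k & Bh_set h B].

Definition is_largest (P : set nat) (m : nat) : Prop :=
  P m /\ forall n, P n -> (n <= m)%N.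

Definition is_smallest (P : set nat) (m : nat) : Prop :=
  P m /\ forall n, P n -> (m <= n)%N.

(* Both are 0 when no such number exists; [fhP], [hkP] and [phiP] below show
   for which parameters this does not happen. *)
Definition largest (P : set nat) : nat := xget 0%N (is_largest P).
Definition smallest (P : set nat) : nat := xget 0%N (is_smallest P).

Definition fh (h v : nat) : nat := largest (fun k => has_Bh h k v).
Definition hk (k v : nat) : nat := largest (fun h => has_Bh h k v).
Definition phi (h k : nat) : nat := smallest (fun v => has_Bh h k v).

Lemma largestP (P : set nat) :
  (exists m, P m) -> (exists u, forall n, P n -> (n <= u)%N) ->
  is_largest P (largest P).
Proof.
move=> [m Pm] [u Pu]; apply: (@xgetPex _ 0%N (is_largest P)).
have exP : exists n, `[< P n >] by exists m; apply/asboolP.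
have ubP n : `[< P n >] -> (n <= u)%N by move/asboolP; exact: Pu.
case: (ex_maxnP exP ubP) => i /asboolP Pi max_i.
by exists i; split=> // n Pn; apply/max_i/asboolP.
Qed.

Lemma smallestP (P : set nat) :
  (exists m, P m) -> is_smallest P (smallest P).
Proof.
move=> [m Pm]; apply: (@xgetPex _ 0%N (is_smallest P)).
have exP : exists n, `[< P n >] by exists m; apply/asboolP.
case: (ex_minnP exP) => i /asboolP Pi min_i.
by exists i; split=> // n Pn; apply/min_i/asboolP.
Qed.

Lemma Bh_setP (G : finZmodType) (h : nat) (B : {set G}) :
  Bh_set h B <->
  (forall s t : seq G, size s = h -> size t = h ->
     {subset s <= B} -> {subset t <= B} ->
     \sum_(x <- s) x = \sum_(x <- t) x -> perm_eq s t).
Proof.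
split=> [HB s t szs szt sB tB eq_st | HB i j si sj eq_ij].
  have code (u : seq G) : size u = h -> {subset u <= B} ->
      exists i : h.-tuple 'I_#|B|, sorted leq [seq val x | x <- i] /\
        perm_eq u [seq enum_val x | x <- i].
    move=> szu uB.
    have [w uE] : exists w : seq 'I_#|B|, u = map enum_val w.
      elim: u uB {szu} => [|x u IHu] uB; first by exists [::].
      case: IHu => [y yu|w ->]; first by apply: uB; rewrite inE yu orbT.
      have xB : x \in B by apply: uB; rewrite inE eqxx.
      by exists (enum_rank_in xB x :: w); rewrite /= enum_rankK_in.
    pose le (x y : 'I_#|B|) := (x <= y)%N.
    have szw : size (sort le w) == h by rewrite size_sort -szu uE size_map.
    exists (Tuple szw); split=> /=; last by rewrite uE perm_map // perm_sym perm_sort.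
    by rewrite sorted_map; apply: sort_sorted => x y; exact: leq_total.
  have [i [si pi]] := code s szs sB.
  have [j [sj pj]] := code t szt tB.
  suff eij : i = j by rewrite (permPl pi) eij perm_sym.
  apply: HB => //.
  by move: eq_st; rewrite (perm_big _ pi) (perm_big _ pj) /= !big_map.
have sub (u : seq 'I_#|B|) : {subset map enum_val u <= B}.
  by move=> _ /mapP[y _ ->]; exact: enum_valP.
have : perm_eq (map enum_val i) (map enum_val j).
  by apply: HB; rewrite ?size_map ?size_tuple // !big_map.
move=> /(perm_map_inj enum_val_inj) pij; apply/val_inj.
apply: (inj_map val_inj); apply: (sorted_eq leq_trans anti_leq) => //.
exact: perm_map.
Qed.

Lemma phiP (h k : nat) : is_smallest (fun v => has_Bh h k v) (phi h k).
Proof.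
apply: smallestP.
pose G : finZmodType := 'rV['I_h.+2]_k.
pose d (i : 'I_k) : G := \row_j (i == j)%:R.
have ev (w : seq 'I_k) j : (\sum_(x <- map d w) x) 0 j = (count_mem j w)%:R.
  rewrite big_map; elim: w => [|x w IHw]; first by rewrite big_nil mxE.
  by rewrite big_cons mxE IHw mxE natrD.
have injn (a b : nat) : (a <= h.+1)%N -> (b <= h.+1)%N ->
    a%:R = b%:R :> 'I_h.+2 -> a = b.
  move=> ah bh /(congr1 val); rewrite /= !Zp_nat /= !modn_small //.
have d_inj : injective d.
  move=> i j /rowP/(_ i); rewrite !mxE eqxx.
  by case: (j =P i) => // _ /(injn 1%N 0%N) => /(_ isT isT).
exists #|[set: G]|, G, [set d i | i in 'I_k]; split=> //.
  by rewrite card_imset // card_ord.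
apply/Bh_setP => s t szs szt sB tB.
have code (u : seq G) : {subset u <= [set d i | i in 'I_k]} ->
    exists w, u = map d w.
  elim: u => [|x u IHu] uB; first by exists [::].
  case: IHu => [y yu|w ->]; first by apply: uB; rewrite inE yu orbT.
  have /imsetP[i _ ->] : x \in [set d i | i in 'I_k].
    by apply: uB; rewrite inE eqxx.
  by exists (i :: w).
have [ws sE] := code s sB; have [wt tE] := code t tB.
move: szs szt; rewrite sE tE !size_map => szs szt /rowP eq_st.
apply: perm_map; apply/allP => j _; apply/eqP.
apply: injn; last by have := eq_st j; rewrite !ev.
  by rewrite (leq_trans (count_size _ _)) // szs.
by rewrite (leq_trans (count_size _ _)) // szt.
Qed.

Lemma fhP (h v : nat) : (0 < v)%N ->
  is_largest (fun k => has_Bh h k v) (fh h v).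
Proof.
move=> v0; apply: largestP; last first.
  by exists v => k [G [B [<- <- _]]]; apply/subset_leq_card/finset.subsetT.
exists 0%N, 'I_v.-1.+1, finset.set0; split; rewrite ?cards0 //.
  by rewrite cardsT card_ord prednK.
apply/Bh_setP; move=> [|x s] [|y t] //= <- //= _ /(_ x).
by rewrite !inE eqxx /= => /(_ isT).
Qed.

Lemma hkP (k v : nat) : (1 < k)%N -> (k <= v)%N ->
  is_largest (fun h => has_Bh h k v) (hk k v).
Proof.
move=> k1 kv; apply: largestP.
  have v0 : (0 < v)%N by apply: leq_trans kv; apply: ltnW.
  pose G : finZmodType := 'I_v.-1.+1.
  have cG : #|[set: G]| = v by rewrite cardsT card_ord prednK.
  have szk : size (take k (enum [set: G])) = k.
    by rewrite size_take -cardE cG; case: ltngtP kv.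
  exists 1%N, G, [set x in take k (enum [set: G])]; split=> //.
    rewrite cardsE -[RHS]szk; apply/card_uniqP; exact/take_uniq/enum_uniq.
  by apply/Bh_setP; move=> [|x []] // [|y []] // _ _ _ _; rewrite !big_seq1 => ->.
exists v => h [G [B [<- cB /Bh_setP HB]]].
have /card_gt1P[a [b [aB bB ab]]] : (1 < #|B|)%N by rewrite cB.
pose s (j : nat) := nseq (h - j) a ++ nseq j b.
have sB j : {subset s j <= B}.
  by move=> x; rewrite mem_cat => /orP[] /nseqP[-> _].
have szs (j : 'I_h.+1) : size (s j) = h.
  by rewrite size_cat !size_nseq subnK // -ltnS.
have inj_s : injective (fun j : 'I_h.+1 => \sum_(x <- s j) x).
  move=> i j /HB; move=> /(_ (szs i) (szs j) (sB i) (sB j)) /permP/(_ (pred1 b)).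
  rewrite !count_cat !count_nseq /= (negbTE ab) eqxx !mul0n !mul1n !add0n.
  exact: val_inj.
apply: ltnW; rewrite cardsT -[h.+1]card_ord.
exact: leq_card inj_s.
Qed.

(* Main.v *)
(* If B = {b_0, ..., b_n} is a B_h set, then x |-> sum x_i (b_i - b_0) is
   injective on any subset of Z^n in which differences have positive and
   negative parts of sum at most h. The vectors with positive part of sum at
   most a and negative part of sum at most c, where a + c = h, form such a
   subset, whose cardinality is
     sum_j C(n, j) C(a, j) C(n - j + c, c) <= v.
   Take a and c to be h/2 rounded up and down. The terms j = a and j = 0 yield
   (i); bounding each falling factorial below by a power and using
   sum_j C(n, j)^2 = C(2n, n) yields (iii). The bounds (ii) and (iv) are (i) and
   (iii) solved for k and h. *)
Require Import Defs.
From mathcomp Require Import all_boot all_order all_algebra.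
From mathcomp Require Import reals exp.
From mathcomp Require Import zify ring lra.
Import Order.TTheory GRing.Theory Num.Theory.
Local Open Scope ring_scope.

(** * Injectivity of bounded combinations *)

(* After translating [b0] to 0, a sum of at most h of the [b i - b0] is padded
   by copies of [b0] to a sum of exactly h elements of B. *)
Lemma Bh_lincomb_inj (G : finZmodType) (h n : nat) (B : {set G})
    (b0 : G) (b : 'I_n -> G) (r r' : 'I_n -> nat) :
  Bh_set h B -> b0 \in B -> (forall i, b i \in B) ->
  injective b -> (forall i, b i != b0) ->
  (\sum_i r i <= h)%N -> (\sum_i r' i <= h)%N ->
  \sum_i (b i - b0) *+ r i = \sum_i (b i - b0) *+ r' i -> r =1 r'.
Proof.
move=> /Bh_setP HB b0B bB b_inj b_b0 rh r'h eq_rr'.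
pose s (f : 'I_n -> nat) :=
  nseq (h - \sum_i f i) b0 ++ flatten [seq nseq (f i) (b i) | i <- enum 'I_n].
have szs f : (\sum_i f i <= h)%N -> size (s f) = h.
  move=> fh; rewrite size_cat size_nseq size_flatten /shape -map_comp.
  rewrite sumnE big_map big_enum /= -[RHS](subnK fh); congr addn.
  by apply: eq_bigr => i _; rewrite size_nseq.
have sB f : {subset s f <= B}.
  move=> x; rewrite mem_cat => /orP[/nseqP[-> _] //|].
  by case/flattenP=> _ /mapP[i _ ->] /nseqP[-> _].
have sums f : (\sum_i f i <= h)%N ->
    \sum_(x <- s f) x = b0 *+ h + \sum_i (b i - b0) *+ f i.
  move=> fh; have sumn m (x : G) : \sum_(y <- nseq m x) y = x *+ m.
    by rewrite big_nseq iter_addr_0.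
  rewrite big_cat /= sumn big_flatten big_map big_enum /=.
  rewrite -[in RHS](subnK fh) mulrnDr -addrA; congr (_ + _).
  rewrite -sumrMnr -big_split /=; apply: eq_bigr => i _.
  by rewrite sumn mulrnBl addrCA subrr addr0.
(* The padding leaves these multiplicities alone because [b i] differs from [b0]. *)
have cnt f i : count_mem (b i) (s f) = f i.
  rewrite count_cat count_nseq /= eq_sym (negbTE (b_b0 i)) mul0n add0n.
  rewrite count_flatten -map_comp sumnE big_map big_enum /=.
  rewrite (bigD1 i) //= count_nseq /= eqxx mul1n big1 ?addn0 // => j ji.
  by rewrite count_nseq /= (inj_eq b_inj) (negbTE ji).
have /permP prr' : perm_eq (s r) (s r').
  by apply: HB; rewrite ?szs // !sums // eq_rr'.
by move=> i; rewrite -[LHS]cnt -[RHS]cnt prr'.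
Qed.

(** * Counting functions by their support *)

(** Stars and bars: a tuple of length |X| with sum at most m is read along [enum X] and extended by
    0. *)
Lemma card_supported_ffuns (I : finType) (X : {set I}) (m : nat) :
  ('C(#|X| + m, m) <=
   #|[set f : {ffun I -> 'I_m.+1} | (\sum_i f i <= m)%N
        & [forall i, (i \in X) || (f i == ord0)]]|)%N.
Proof.
rewrite -bin_sub ?leq_addl // addnK -card_partial_ord_partitions.
pose F (t : #|X|.-tuple 'I_m.+1) := [ffun i => nth ord0 t (index i (enum X))].
have FX t i : i \notin X -> F t i = ord0.
  by move=> iX; rewrite ffunE nth_default // size_tuple cardE memNindex ?mem_enum.
have idx j x0 : (j < #|X|)%N -> index (nth x0 (enum X) j) (enum X) = j.
  by move=> jX; rewrite index_uniq ?enum_uniq -?cardE.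
rewrite -(@card_in_imset _ _ F) => [|t u _ _ /ffunP eqF].
  apply: subset_leq_card; apply/subsetP => f /imsetP[t].
  rewrite inE => tm ->; rewrite inE; apply/andP; split; last first.
    by apply/forallP => i; case: (boolP (i \in X)) => //= /FX->.
  rewrite (bigID [in X]) /= [X in (_ + X)%N]big1 ?addn0 => [|i /FX-> //].
  apply: leq_trans tm; rewrite -big_enum.
  case: (pickP [in X]) => [x0 _|X0]; last by rewrite (eq_enum X0) enum0 big_nil.
  rewrite (big_nth x0) -cardE big_mkord [leqRHS]big_tuple; apply: leq_sum => j _.
  by rewrite ffunE idx // -tnth_nth.
apply/val_inj/(@eq_from_nth _ ord0) => [|j]; rewrite !size_tuple // => jX.
have [x0 _] : exists x, x \in X by apply/card_gt0P; apply: leq_trans jX.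
by have := eqF (nth x0 (enum X) j); rewrite !ffunE idx.
Qed.

(** Adding 1 on X turns a function vanishing off X with sum at most a - |X| into one with support
    exactly X and sum at most a. *)
Lemma card_ffuns_of_support (I : finType) (X : {set I}) (a : nat) :
  ('C(a, #|X|) <=
   #|[set f : {ffun I -> 'I_a.+1} | (\sum_i f i <= a)%N
        & [set i | f i != ord0] == X]|)%N.
Proof.
have [aX|Xa] := ltnP a #|X|; first by rewrite bin_small.
rewrite -{1}(subnKC Xa) -bin_sub ?leq_addr // addKn.
apply: leq_trans (card_supported_ffuns I X (a - #|X|)) _.
pose F (f : {ffun I -> 'I_(a - #|X|).+1}) : {ffun I -> 'I_a.+1} :=
  [ffun i => if i \in X then inord (f i).+1 else ord0].
(* [inord] keeps the value: X is nonempty, so f i + 1 <= a - |X| + 1 <= a. *)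
have Fval (f : {ffun I -> 'I_(a - #|X|).+1}) i : (i \in X) ->
    (\sum_i f i <= a - #|X|)%N -> F f i = (f i).+1 :> nat.
  move=> iX fa; rewrite ffunE iX inordK // ltnS.
  have X1 : (0 < #|X|)%N by apply/card_gt0P; exists i.
  by apply: leq_trans (ltn_ord _) _; rewrite ltn_subrL X1 (leq_trans X1).
rewrite -(@card_in_imset _ _ F) => [|f g].
  apply: subset_leq_card; apply/subsetP => g /imsetP[f].
  rewrite inE => /andP[fa /forallP fX] ->; rewrite inE; apply/andP; split.
    rewrite (bigID [in X]) /= [X in (_ + X)%N]big1 => [|i /negbTE iX]; last first.
      by rewrite ffunE iX.
    rewrite addn0 (eq_bigr (fun i => f i + 1)%N) => [|i iX]; last first.
      by rewrite Fval // addn1.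
    rewrite big_split /= sum1_card addnC -leq_subRL //.
    by apply: leq_trans fa; rewrite [leqRHS](bigID [in X]) leq_addr.
  apply/eqP/setP => i; rewrite inE; case: (boolP (i \in X)) => iX.
    by rewrite -val_eqE /= Fval.
  by rewrite ffunE (negbTE iX) eqxx.
rewrite !inE => /andP[fa /forallP fX] /andP[ga /forallP gX] /ffunP eqF.
apply/ffunP => i; have := fX i; have := gX i; case: (boolP (i \in X)) => /= iX.
  by move=> _ _; apply/val_inj/succn_inj; rewrite -!Fval // eqF.
by move=> /eqP-> /eqP->.
Qed.

(** * The counting bound on the order of the group *)

(* The left-hand side counts the x in Z^n whose positive part has sum at most a
   and whose negative part has sum at most c, by the set of j positive
   coordinates. *)
Lemma Bh_anticode_bound (a c n v : nat) :
  has_Bh (a + c) n.+1 v ->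
  (\sum_(j < n.+1) 'C(n, j) * ('C(a, j) * 'C(n - j + c, c)) <= v)%N.
Proof.
move=> [G [B [<- cB HB]]].
pose e (i : 'I_n.+1) : G := nth 0 (enum B) i.
have szB : size (enum B) = n.+1 by rewrite -cardE.
have eB i : e i \in B by rewrite -mem_enum mem_nth ?szB.
have e_inj : injective e.
  by move=> i j /eqP; rewrite nth_uniq ?szB ?enum_uniq // => /eqP/val_inj.
pose b (i : 'I_n) := e (lift ord0 i).
have b_inj : injective b by move=> i j /e_inj/lift_inj.
have b_b0 i : b i != e ord0 by rewrite (inj_eq e_inj) eq_sym neq_lift.
pose T : finType := ({ffun 'I_n -> 'I_a.+1} * {ffun 'I_n -> 'I_c.+1})%type.
pose E := [set x : T | [&& (\sum_i x.1 i <= a)%N, (\sum_i x.2 i <= c)%N &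
  [forall i, (x.1 i == ord0) || (x.2 i == ord0)]]].
pose F (x : T) : G :=
  \sum_i (b i - e ord0) *+ x.1 i - \sum_i (b i - e ord0) *+ x.2 i.
have F_inj : {in E &, injective F}.
  move=> [p q] [p' q']; rewrite !inE /=.
  move=> /and3P[pa qc /forallP pq] /and3P[p'a q'c /forallP pq'] /eqP.
  rewrite /F /= subr_eq addrAC eq_sym subr_eq eq_sym -!big_split /= => /eqP eqF.
  (* With the subtracted sums moved across, both sides have nonnegative coefficients of sum at most
     a + c. *)
  have eq_i i : (p i + q' i = p' i + q i)%N.
    apply: (@Bh_lincomb_inj _ _ _ _ _ b (fun i => p i + q' i)%N
      (fun i => p' i + q i)%N HB (eB ord0)) => // [j|||].
    - exact: eB.
    - by rewrite big_split leq_add.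
    - by rewrite big_split leq_add.
    - by under eq_bigr do rewrite mulrnDr; under [RHS]eq_bigr do rewrite mulrnDr.
  (* At each i one of p, q and one of p', q' vanishes, so the integer p i - q i = p' i - q' i
     determines both parts. *)
  have eq_pq i : (p i = p' i :> nat) /\ (q i = q' i :> nat).
    by move: (eq_i i) (pq i) (pq' i); rewrite -!val_eqE /=; lia.
  by congr pair; apply/ffunP => i; apply/val_inj; case: (eq_pq i).
apply: (@leq_trans #|E|); last first.
  by rewrite -(card_in_imset F_inj) cardsT max_card.
pose D (x : T) : {set 'I_n} := [set i | x.1 i != ord0].
rewrite -[#|E|]sum1_card (partition_big D predT) //=.
(* C(n, j) of the sets J have j elements. *)
apply: (@leq_trans (\sum_(J : {set 'I_n}) 'C(a, #|J|) * 'C(n - #|J| + c, c))%N).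
  rewrite (partition_big (fun J : {set 'I_n} => inord #|J| : 'I_n.+1) predT) //=.
  apply: leq_sum => j _.
  have sJ (J : {set 'I_n}) : (inord #|J| : 'I_n.+1) = #|J| :> nat.
    by rewrite inordK // ltnS (leq_trans (max_card _)) ?card_ord.
  rewrite -{1}[n]card_ord -card_draws -sum1_card big_distrl /=.
  rewrite [leqRHS](eq_bigl [in [set J : {set 'I_n} | #|J| == j]]) => [|J].
    by apply: leq_sum => J; rewrite inE mul1n => /eqP->.
  by rewrite inE -val_eqE /= sJ.
apply: leq_sum => J _; rewrite sum1_card.
have -> : (n - #|J| = #|~: J|)%N by rewrite [RHS]cardsCs setCK card_ord.
(* For fixed J, choose p with support exactly J and, independently, q vanishing on J. *)
apply: leq_trans (leq_mul (card_ffuns_of_support _ J a)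
  (card_supported_ffuns _ (~: J) c)) _.
rewrite -cardsX; apply: subset_leq_card; apply/subsetP => -[p q].
rewrite inE /= !inE /= => /andP[/andP[pa /eqP pJ] /andP[qc /forallP qJ]].
rewrite unfold_in /= inE /= pa qc /D /= pJ eqxx andbT; apply/forallP => i.
by have := qJ i; rewrite -pJ !inE negbK.
Qed.

(** * Power estimates from the counting bound *)

Lemma leq_exp_ffact (x q m n : nat) :
  (forall i, i < n -> x <= q * (m - i))%N -> (x ^ n <= q ^ n * m ^_ n)%N.
Proof.
move=> xq; rewrite ffact_prod.
elim: n xq => [|n IHn] xq; first by rewrite big_ord0.
rewrite big_ord_recr /= !expnSr mulnACA leq_mul ?xq // IHn // => i /ltnW.
exact: xq.
Qed.

Lemma has_Bh_gt0 (h k v : nat) : has_Bh h k v -> (0 < v)%N.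
Proof. by move=> [G [B [<- _ _]]]; apply/card_gt0P; exists 0; rewrite inE. Qed.

Lemma expn_lt_Bh_order (a c k v : nat) :
  has_Bh (a + c) k v -> (0 < a)%N -> (a <= k)%N ->
  ((k - a) ^ (a + c) < v * (a`! * c`!))%N.
Proof.
move=> Hv a0; case: k Hv => [|n] Hv; first by rewrite leqNgt a0.
(* For a = k = n + 1 there is no term j = a, but the power is 0. *)
rewrite leq_eqVlt => /predU1P[ak|an].
  by rewrite ak subnn exp0n // !muln_gt0 !fact_gt0 (has_Bh_gt0 _ _ _ Hv).
have := Bh_anticode_bound _ _ _ _ Hv.
(* The term [j = a] alone gives the weak inequality, [j = 0] the strictness. *)
rewrite (bigD1 ord0) //= !bin0 !mul1n (bigD1 (inord a)) /=; last first.
  by rewrite -val_eqE /= inordK // -lt0n.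
rewrite inordK ?ltnS // binn mul1n subn0 => bound.
have {bound} : ('C(n, a) * 'C(n - a + c, c) < v)%N.
  apply: leq_trans bound; rewrite addnA; apply: leq_trans (leq_addr _ _).
  by rewrite -add1n leq_add2r bin_gt0 leq_addl.
rewrite -(ltn_pmul2r (_ : 0 < a`! * c`!)%N) ?muln_gt0 ?fact_gt0 //.
apply: leq_ltn_trans; rewrite mulnACA !bin_ffact expnD.
(* Every factor of n^_a and of (n - a + c)^_c is at least n - a + 1 = k - a. *)
by apply: leq_mul; rewrite -[leqRHS]mul1n;
  [rewrite -(exp1n a) | rewrite -(exp1n c)];
  apply: leq_exp_ffact => i; lia.
Qed.

(** Vandermonde's identity splits the left side into terms that are compared index by index with
    those of [Bh_anticode_bound]. The factor 2^n is spread over the n factors of the falling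
    factorials, so that halves are avoided. *)
Lemma expn_bin_lt_Bh_order (a c n v : nat) :
  has_Bh (a + c) n.+1 v -> (0 < n)%N -> (c <= a <= c.+1)%N ->
  (2 * n - 2 <= a + c)%N ->
  ((a + c + 2 - 2 * n) ^ n * 'C(2 * n, n) < v * (n`! * 2 ^ n))%N.
Proof.
move=> Hv n0 ca hn; set u := (_ - 2 * n)%N.
have := Bh_anticode_bound _ _ _ _ Hv.
rewrite -(leq_pmul2r (_ : 0 < n`! * 2 ^ n)%N) ?muln_gt0 ?fact_gt0 ?expn_gt0 //.
apply: leq_trans.
rewrite mul2n -addnn -binomial.Vandermonde mulnC !big_distrl /=.
have term (j : 'I_n.+1) :
    ('C(n, j) * ('C(a, j) * 'C(n - j + c, c)) * (n`! * 2 ^ n) =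
      'C(n, j) * 'C(n, n - j) *
      ((2 ^ j * a ^_ j) * (2 ^ (n - j) * (n - j + c) ^_ (n - j))))%N.
  have jn : (j <= n)%N by rewrite -ltnS.
  have -> : 'C(n - j + c, c) = 'C(n - j + c, n - j).
    by rewrite -bin_sub ?leq_addl // addnK.
  have -> : (2 ^ n = 2 ^ j * 2 ^ (n - j))%N by rewrite -expnD subnKC.
  rewrite (bin_sub jn) -!bin_ffact -(bin_fact jn); ring.
(* The doubled factors are at least 2(a - n + 1) and 2(c + 1); both dominate u because a and c
   differ by at most 1. *)
have Hu (j : 'I_n.+1) :
    (u ^ n <= (2 ^ j * a ^_ j) * (2 ^ (n - j) * (n - j + c) ^_ (n - j)))%N.
  have jn : (j <= n)%N by rewrite -ltnS.
  rewrite -{1}(subnKC jn) expnD; apply: leq_mul; apply: leq_exp_ffact => i; lia.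
(* Strictness comes from j = 0, where every doubled factor is at least 2(c + 1) >= a + c + 1 > u. *)
rewrite big_ord_recl [leqRHS]big_ord_recl -addSn; apply: leq_add.
  rewrite term /= bin0 !mul1n subn0 binn !mul1n.
  apply: (@leq_trans ((a + c).+1 ^ n)); first by rewrite ltn_exp2r //; lia.
  by apply: leq_exp_ffact => i; lia.
by apply: leq_sum => i _; rewrite term leq_mul2l Hu orbT.
Qed.

(** * Real roots and the four bounds *)

Lemma ltr_powR_root (R : realType) (x y : R) (n : nat) :
  (0 < n)%N -> 0 <= x -> x ^+ n < y -> x < y `^ (1 / n%:R).
Proof.
move=> n0 x0 xy; have y0 : 0 <= y by rewrite ltW // (le_lt_trans _ xy) ?exprn_ge0.
rewrite -(ltr_pXn2r n0) ?nnegrE ?powR_ge0 // -[ltRHS]powR_mulrn ?powR_ge0 //.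
by rewrite -powRrM div1r mulVf ?pnatr_eq0 -?lt0n // powRr1.
Qed.

Theorem theorem2p2 (R : realType) :
  [/\ forall h k : nat, (1 <= h)%N -> (uphalf h <= k)%N ->
        (phi h k)%:R >
          (k%:R - (uphalf h)%:R) ^+ h
            / (((uphalf h)`!)%:R * ((h./2)`!)%:R) :> R,
      forall h v : nat, (1 <= h)%N -> (2 <= v)%N ->
        (fh h v)%:R <
          v%:R `^ (1 / h%:R)
            * (((h./2)`!)%:R * ((uphalf h)`!)%:R) `^ (1 / h%:R)
          + (uphalf h)%:R :> R,
      forall h k n : nat, k = n.+1 -> (2 <= k)%N -> (2 * k - 4 <= h)%N ->
        (phi h k)%:R >
          (h%:R - 2 * n%:R + 2) ^+ n / (n`!)%:R
            * (('C(2 * n, n))%:R / 2 ^+ n) :> R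
    & forall k n v : nat, k = n.+1 -> (2 <= k)%N -> (2 <= v)%N -> (k <= v)%N ->
        (hk k v)%:R <
          v%:R `^ (1 / n%:R)
            * (2 * (((n`!) ^ 3)%:R / ((2 * n)`!)%:R) `^ (1 / n%:R))
          + 2 * n%:R - 2 :> R ].
Proof.
(* Stated for every admissible triple, this gives (i) at v = [phi h k] and (ii) at k = [fh h v];
   [part3] serves (iii) and (iv) likewise. *)
have part1 h k v : (1 <= h)%N -> (uphalf h <= k)%N -> has_Bh h k v ->
    (k%:R - (uphalf h)%:R) ^+ h < v%:R * ((uphalf h)`!%:R * (h./2)`!%:R) :> R.
  move=> h1 hk; have hE : (uphalf h + h./2 = h)%N by lia.
  rewrite -{1}hE => /expn_lt_Bh_order; rewrite hE => /(_ ltac:(lia) hk) bound.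
  by rewrite -natrB // -natrX -!natrM ltr_nat.
have part3 h n v : (0 < n)%N -> (2 * n - 2 <= h)%N -> has_Bh h n.+1 v ->
    (h%:R - 2 * n%:R + 2) ^+ n * 'C(2 * n, n)%:R < v%:R * (n`!%:R * 2 ^+ n) :> R.
  move=> n0 nh; have hE : (uphalf h + h./2 = h)%N by lia.
  rewrite -{1}hE => /expn_bin_lt_Bh_order; rewrite hE.
  move=> /(_ n0 ltac:(lia) nh); rewrite -(ltr_nat R) !natrM !natrX.
  by rewrite natrB; [rewrite natrD natrM addrAC | lia].
have fact0 m : 0 < m`!%:R :> R by rewrite ltr0n fact_gt0.
split.
- move=> h k h1 hk; have [Hv _] := phiP h k.
  by rewrite ltr_pdivrMr ?mulr_gt0 // part1.
- move=> h v h1 v2; have [Hv _] := fhP h (ltnW v2).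
  rewrite -powRM ?ler0n // ?mulr_ge0 // -ltrBlDr.
  (* Below [uphalf h] the left side is negative and the bound is trivial. *)
  have [hk|kh] := leqP (uphalf h) (fh h v).
    apply: ltr_powR_root => //; first by rewrite subr_ge0 ler_nat.
    by rewrite [(h./2)`!%:R * _]mulrC part1.
  apply: lt_le_trans (powR_ge0 _ _); by rewrite subr_lt0 ltr_nat.
- move=> h k n -> k2 hk; have [Hv _] := phiP h n.+1.
  rewrite mulrACA -invfM ltr_pdivrMr ?mulr_gt0 ?exprn_gt0 //.
  by apply: part3 => //; lia.
- move=> k n v -> k2 v2 kv; have [Hv _] := hkP k2 kv.
  have n0 : (0 < n)%N by lia.
  set h := hk n.+1 v in Hv *.
  set q : R := (n`! ^ 3)%:R / _.
  have q0 : 0 < q by rewrite divr_gt0 // ltr0n expn_gt0 fact_gt0.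
  have v0 : 0 < v%:R :> R by rewrite ltr0n; lia.
  rewrite mulrCA -powRM ?ltW //.
  (* Halving absorbs the factor 2 of (iv) and leaves a pure n-th root on the right. *)
  suff : (h%:R - 2 * n%:R + 2) / 2 < (v%:R * q) `^ (1 / n%:R) by lra.
  have [nh|hn] := leqP (2 * n - 2) h; last first.
    apply: lt_le_trans (powR_ge0 _ _).
    have : (h + 2)%:R < (2 * n)%:R :> R by rewrite ltr_nat; lia.
    by rewrite natrD natrM; lra.
  have hn : (2 * n)%:R <= (h + 2)%:R :> R by rewrite ler_nat; lia.
  apply: ltr_powR_root => //.
    by move: hn; rewrite natrD natrM; lra.
  have C0 : 0 < 'C(2 * n, n)%:R :> R by rewrite ltr0n bin_gt0; lia.
  (* In this form the n-th power of the goal is [part3] divided by 2^n C(2n, n). *)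
  have -> : q = n`!%:R / 'C(2 * n, n)%:R.
    rewrite /q; have -> : (2 * n)`! = ('C(2 * n, n) * (n`! * n`!))%N.
      by rewrite -(@bin_fact (2 * n) n) ?mul2n -?addnn ?leq_addr ?addnK.
    by rewrite natrX !natrM; field; rewrite !gt_eqF.
  rewrite expr_div_n mulrA ltr_pdivlMr // mulrAC ltr_pdivrMr ?exprn_gt0 //.
  by rewrite -mulrA part3.
Qed.
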